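(* For every real $s>2$, there exist positive definite matrices $A,B\in M_3(\mathbb C)$ and a nonnegative nondecreasing continuous real function $f$ on an interval containing $\operatorname{spec}(A)$ such that \[ \operatorname{Tr} f(A)A^sB^s<\operatorname{Tr} f(A)(A^{1/2}BA^{1/2})^s . \] Consequently, it is false in general that $\operatorname{Tr} f(A)A^sB^s\geq \operatorname{Tr} f(A)(A^{1/2}BA^{1/2})^s$ for all $s\geq 1$, all positive semidefinite $A,B$ and all nonnegative nondecreasing $f$ on an interval containing $\operatorname{spec}(A)$.
   Context: Powers and functions of Hermitian matrices are taken by the functional calculus; $\operatorname{spec}(A)$ is the set of eigenvalues of $A$. *)

(* Defs.v *)
From mathcomp Require Import all_boot all_order all_algebra.
From mathcomp Require Import all_classical all_reals all_analysis.
From mathcomp Require Export complex.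

Set Implicit Arguments.
Unset Strict Implicit.
Unset Printing Implicit Defensive.
Import Order.TTheory GRing.Theory Num.Theory.
Import numFieldNormedType.Exports.
Local Open Scope ring_scope.
Local Open Scope classical_set_scope.
Local Open Scope complex_scope.
Local Open Scope sesquilinear_scope.

(* On R[i], [0 < z] and [0 <= z] also assert that z is real. *)
Definition posdefmx (R : realType) (n : nat) (A : 'M[R[i]]_n) : Prop :=
  A \is hermsymmx /\
  forall v : 'cV[R[i]]_n, v != 0 -> 0 < (v ^t* *m A *m v) 0 0.

Definition possemidefmx (R : realType) (n : nat) (A : 'M[R[i]]_n) : Prop :=
  A \is hermsymmx /\
  forall v : 'cV[R[i]]_n, 0 <= (v ^t* *m A *m v) 0 0.

Definition spec (R : realType) (n : nat) (A : 'M[R[i]]_n) : set R[i] :=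
  [set z | eigenvalue A z].

(* Functional calculus f(A) for Hermitian A, through the unitary
   diagonalization A = U^* diag(d) U of the library. The entries of d are
   real, so only their real parts are passed to f; by [mxfunE] the result
   does not depend on the diagonalization, and f matters only on the
   spectrum of A. *)
Definition mxfun (R : realType) (n : nat) (f : R -> R) (A : 'M[R[i]]_n) :
    'M[R[i]]_n :=
  (spectralmx A) ^t*
  *m diag_mx (map_mx (fun z => (f (complex.Re z))%:C) (spectral_diag A))
  *m spectralmx A.

(* For x = 0, [powR x s] is 0 when s != 0 and 1 when s = 0. *)
Definition mxpowR (R : realType) (n : nat) (A : 'M[R[i]]_n) (s : R) :
    'M[R[i]]_n :=
  mxfun (fun x => powR x s) A.

Lemma mxfunE (R : realType) (n : nat) (f : R -> R) (U : 'M[R[i]]_n)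
    (d : 'rV[R]_n) : U \is unitarymx ->
  mxfun f (U ^t* *m diag_mx (map_mx (real_complex R) d) *m U) =
  U ^t* *m diag_mx (map_mx (fun x => (f x)%:C) d) *m U.
Proof.
move=> Uu; set D := diag_mx _; set A := _ *m D *m U.
have UU : U ^t* *m U = 1%:M by apply: mulmx1C; apply/unitarymxP.
have UU' : U *m U ^t* = 1%:M by apply/unitarymxP.
have HA : A \is normalmx.
  apply/orthomx_spectral_subproof; exists (U, map_mx (real_complex R) d) => //=.
  by rewrite invmx_unitary.
have /orthomx_spectralP := HA; rewrite /mxfun.
set P := spectralmx A; set e := spectral_diag A.
have Pu : P \is unitarymx := spectral_unitarymx A.
have PP : P *m P ^t* = 1%:M by apply/unitarymxP.
have PP' : P ^t* *m P = 1%:M by apply: mulmx1C.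
rewrite invmx_unitary// => AE.
pose W := U *m P ^t*.
have DW : D *m W = W *m diag_mx e.
  rewrite /W -(mulmxA U) -[LHS]mul1mx -UU' -!mulmxA.
  congr (_ *m _); rewrite !mulmxA -/A AE -!mulmxA PP mulmx1 //.
set E := diag_mx (map_mx _ e); set F := diag_mx (map_mx _ d).
have FW : F *m W = W *m E.
  move: (W) DW => V DV; apply/matrixP => i j; have /matrixP/(_ i j) := DV.
  rewrite /D /F /E !mul_diag_mx !mul_mx_diag !mxE.
  have [->|W0] := eqVneq (V i j) 0; first by rewrite !mulr0 !mul0r.
  by rewrite [RHS]mulrC => /(mulIf W0) <-; rewrite mulrC.
have -> : P ^t* = U ^t* *m W by rewrite /W mulmxA UU mul1mx.
by rewrite -(mulmxA _ W) -FW /W -!mulmxA PP' mulmx1.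
Qed.

(* Main.v *)
(* If A is diagonal with first entry 1 and f(A) = (1/2) e_1 e_1^T, the
   inequality reads (B^s)_11 < (C^s)_11 with C = A^(1/2) B A^(1/2). Were A the
   projection onto the first two coordinates, C would be a compression of B,
   and for s > 2 the function x^s is not operator convex, so compressing can
   increase (B^s)_11.

   Take B with eigenvectors (0,1,1), (2,-1,1), (1,1,-1): the large eigenvalue on
   (0,1,1) is invisible to e_1, so (B^s)_11 is bounded while C feels it. To stay
   exact, choose the vector v = (t,3,1) first and let A be the diagonal matrix
   for which B v = l A^-1 v; then A^(-1/2) v is an eigenvector of C for l, and
   Cauchy-Schwarz for the semi-inner product of C^s bounds (C^s)_11 below by
   l^s t^2 / (v^T A^-1 v). With l = 24 L and t close to 1/(2 L) the claim holds
   as soon as L^(s-2) is large; L^(s-2) = 45 suffices. *)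

Require Import Defs.
From mathcomp Require Import all_boot all_order all_algebra.
From mathcomp Require Import all_classical all_reals all_analysis.
From mathcomp Require Import ring lra.
Import Order.TTheory GRing.Theory Num.Theory.
Import numFieldNormedType.Exports.
Local Open Scope ring_scope.
Local Open Scope classical_set_scope.
Local Open Scope complex_scope.
Local Open Scope sesquilinear_scope.

(** * Hermitian matrices and their functional calculus *)

Lemma hermsymmx_trC (C : numClosedFieldType) (n : nat) (A : 'M[C]_n) :
  (A \is hermsymmx) = (A ^t* == A).
Proof. by rewrite qualifE /= expr0 scale1r eq_sym. Qed.

Lemma hermsymmx_mul3 (C : numClosedFieldType) (n : nat) (G B : 'M[C]_n) :
  G \is hermsymmx -> B \is hermsymmx -> G *m B *m G \is hermsymmx.
Proof.
rewrite !hermsymmx_trC => /eqP GE /eqP BE.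
by rewrite !trmx_mul !map_mxM /= GE BE mulmxA.
Qed.

Lemma conjC_real (R : rcfType) (x : R) : (x%:C : R[i])^*%R = x%:C.
Proof. exact: conjc_real. Qed.

Section FunctionalCalculus.
Variables (R : realType) (n : nat).
Implicit Types (f : R -> R) (A : 'M[R[i]]_n) (u e : 'cV[R[i]]_n).

(** In the eigenbasis of [A], every nonzero coordinate of [u] sits at an eigenvalue equal to [a], so
    [f] acts there as [f a]. *)
Lemma mxfun_eigenvector f A u (a : R) : A \is hermsymmx ->
  A *m u = a%:C *: u -> mxfun f A *m u = (f a)%:C *: u.
Proof.
move=> /hermitian_normalmx /orthomx_spectralP.
rewrite /mxfun; set P := spectralmx A; set d := spectral_diag A.
have Pu : P \is unitarymx := spectral_unitarymx A.
have PP : P *m P ^t* = 1%:M by apply/unitarymxP.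
have PP' : P ^t* *m P = 1%:M by apply: mulmx1C.
rewrite invmx_unitary// => AE Au.
have dPu : diag_mx d *m (P *m u) = a%:C *: (P *m u).
  by rewrite scalemxAr -Au {1}AE !mulmxA PP mul1mx.
suff fPu : diag_mx (map_mx (fun z => (f (complex.Re z))%:C) d) *m (P *m u)
    = (f a)%:C *: (P *m u).
  by rewrite -!mulmxA fPu -scalemxAr mulmxA PP' mul1mx.
apply/colP => i; have /colP/(_ i) := dPu; rewrite !mul_diag_mx !mxE.
set w := BIG_F; have [->|w0] := eqVneq (\sum_j P i j * u j 0) 0.
  by rewrite !mulr0.
by move=> /(mulIf w0) ->.
Qed.

Lemma mxfun_trC f A : (mxfun f A) ^t* = mxfun f A.
Proof.
rewrite /mxfun !trmx_mul !map_mxM /= trmxCK mulmxA; congr (_ *m _ *m _).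
rewrite tr_diag_mx map_diag_mx; congr diag_mx.
by apply/rowP => i; rewrite !mxE /= conjC_real.
Qed.

Lemma mxfun_hermsymmx f A : mxfun f A \is hermsymmx.
Proof. by rewrite hermsymmx_trC mxfun_trC. Qed.

Lemma mxfun_ge0 f A u : (forall x, 0 <= f x) ->
  0 <= (u ^t* *m mxfun f A *m u) 0 0.
Proof.
move=> f0; rewrite /mxfun; set P := spectralmx A.
rewrite !mulmxA -(mulmxA _ P).
have -> : u ^t* *m P ^t* = (P *m u) ^t* by rewrite trmx_mul map_mxM.
rewrite mxE sumr_ge0// => j _; rewrite mul_mx_diag !mxE mulrAC.
by rewrite mulr_ge0 ?lecR// mulrC mul_conjC_ge0.
Qed.

Lemma mxfun_diag f (a : 'rV[R]_n) :
  mxfun f (diag_mx (map_mx (real_complex R) a)) =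
  diag_mx (map_mx (fun x => (f x)%:C) a).
Proof.
have tC1 : (1%:M : 'M[R[i]]_n) ^t* = 1%:M by rewrite trmx1 map_mx1.
have := @mxfunE R n f 1%:M a; rewrite tC1 !mul1mx !mulmx1; apply.
by apply/unitarymxP; rewrite tC1 mulmx1.
Qed.

(** Cauchy-Schwarz for the form of [f(A)], applied to [u] and the basis vector [e_k], with one
    factor [f l] cancelled. The proof evaluates the form at [w], which is [N] times the part of
    [e_k] orthogonal to [u]; this avoids dividing by [f l]. *)
Lemma mxfun_entry_ge f (A : 'M[R[i]]_n) (u : 'cV[R]_n) (l : R) (k : 'I_n) :
  A \is hermsymmx -> (forall x, 0 <= f x) ->
  A *m map_mx (real_complex R) u = l%:C *: map_mx (real_complex R) u ->
  (f l * u k 0 ^+ 2)%:C <= (\sum_j u j 0 ^+ 2)%:C * mxfun f A k k.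
Proof.
move=> Ah f0 Au; set N := \sum_j _; set U := map_mx _ u in Au.
have N0 : 0 <= N by apply: sumr_ge0 => j _; exact: sqr_ge0.
have [N_eq0|NN0] := eqVneq N 0.
  have uk : u k 0 = 0.
    apply/eqP; rewrite -sqrf_eq0; apply/eqP.
    by move/psumr_eq0P: N_eq0 => -> // j _; exact: sqr_ge0.
  by rewrite uk N_eq0 expr0n/= mulr0 mul0r.
have GU := mxfun_eigenvector f _ _ _ Ah Au.
set G := mxfun f A in GU *.
have UG : U ^t* *m G = (f l)%:C *: U ^t*.
  rewrite -[G in LHS](mxfun_trC f A) -map_mxM -trmx_mul GU.
  by apply/rowP => i; rewrite !mxE rmorphM /= conjC_real.
have UtC : U ^t* = U^T.
  by apply/rowP => i; rewrite !mxE /= conjC_real.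
rewrite UtC in UG.
pose e : 'cV[R[i]]_n := delta_mx k 0.
(* Up to the factor N, the claim is [0 <= w^* f(A) w]. *)
pose w := N%:C *: e - (u k 0)%:C *: U.
have wtC : w ^t* = N%:C *: e^T - (u k 0)%:C *: U^T.
  by apply/rowP => i; rewrite !mxE rmorphB !rmorphM /= !conjC_real conjC_nat.
have := mxfun_ge0 f A w f0; rewrite -/G wtC.
have UU : (U^T *m U) 0 0 = N%:C.
  rewrite mxE rmorph_sum; apply: eq_bigr => j _.
  by rewrite !mxE -rmorphM /= expr2.
have Ue : (U^T *m e) 0 0 = (u k 0)%:C by rewrite /e -colE !mxE.
have eU : (e^T *m U) 0 0 = (u k 0)%:C by rewrite /e trmx_delta -rowE !mxE.
have eGe : (e^T *m G *m e) 0 0 = G k k.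
  by rewrite /e trmx_delta -rowE -colE !mxE.
have -> : ((N%:C *: e^T - (u k 0)%:C *: U^T) *m G *m w) 0 0
  = N%:C * (N%:C * G k k - (f l * u k 0 ^+ 2)%:C).
  rewrite mulmxBl -!scalemxAl UG /w mulmxBl -!scalemxAl !mulmxBr -!scalemxAr.
  rewrite -(mulmxA _ G U) GU -!scalemxAr.
  have scE (a : R[i]) (M : 'M[R[i]]_1) : (a *: M) 0 0 = a * M 0 0.
    by rewrite mxE.
  have subE (M M' : 'M[R[i]]_1) : (M - M') 0 0 = M 0 0 - M' 0 0.
    by rewrite !mxE.
  by rewrite !(scE, subE) eGe UU Ue eU rmorphM rmorphXn /=; ring.
by rewrite pmulr_rge0 ?subr_ge0// ltcR lt0r NN0 N0.
Qed.
End FunctionalCalculus.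

(** * Real diagonal matrices *)

Section RealDiagonal.
Variables (R : realType) (n : nat) (a : 'rV[R]_n).
Let A := diag_mx (map_mx (real_complex R) a).

Lemma spec_diag : spec A `<=` range (real_complex R).
Proof.
move=> z /eigenvalueP[v vA v0].
have [j vj] : exists j, v 0 j != 0.
  apply/existsP; apply: contraNT v0 => /existsPn v0; apply/eqP/rowP => j.
  by rewrite mxE; apply/eqP; have := v0 j; rewrite negbK.
exists (a 0 j) => //; have /rowP/(_ j) := vA.
by rewrite mul_mx_diag !mxE [in RHS]mulrC => /(mulfI vj).
Qed.

Lemma posdefmx_diag : (forall j, 0 < a 0 j) -> posdefmx A.
Proof.
move=> a0; split.
  rewrite hermsymmx_trC tr_diag_mx map_diag_mx; apply/eqP; congr diag_mx.
  by apply/rowP => j; rewrite !mxE /= conjC_real.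
move=> v v0.
have [j vj] : exists j, v j 0 != 0.
  apply/existsP; apply: contraNT v0 => /existsPn v0; apply/eqP/colP => j.
  by rewrite mxE; apply/eqP; have := v0 j; rewrite negbK.
have vE k : (v ^t* *m A) 0 k * v k 0 = (a 0 k)%:C * `|v k 0| ^+ 2.
  by rewrite mul_mx_diag !mxE normCK; ring.
rewrite mxE (bigD1 j)//= vE; apply: ltr_pwDl.
  by apply: mulr_gt0; rewrite ?ltcR// exprn_gt0// normr_gt0.
apply: sumr_ge0 => k _; rewrite vE; apply: mulr_ge0; last exact: exprn_ge0.
by rewrite lecR ltW.
Qed.

Lemma mulmx_mxfun_diag f m (M : 'M[R[i]]_(n, m)) j k :
  (mxfun f A *m M) j k = (f (a 0 j))%:C * M j k.
Proof. by rewrite mxfun_diag mul_diag_mx !mxE. Qed.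

(** Reduces both traces of the inequality to a corner entry, once [f] kills all diagonal entries of
    [A] but one. *)
Lemma mxtrace_mxfun_diag f (M : 'M[R[i]]_n) j :
  (forall k, k != j -> f (a 0 k) = 0) ->
  \tr (mxfun f A *m M) = (f (a 0 j))%:C * M j j.
Proof.
move=> f0; rewrite /mxtrace (bigD1 j)//= mulmx_mxfun_diag.
by rewrite big1 ?addr0// => k kj; rewrite mulmx_mxfun_diag f0// mul0r.
Qed.

(* The generalized eigenvalue problem [B v = l A^-1 v] becomes an ordinary one
   for [A^(1/2) B A^(1/2)] under the substitution [u = A^(-1/2) v]. *)
Lemma sandwich_eigenvector (B : 'M[R]_n) (v : 'cV[R]_n) (l : R) :
  (forall j, 0 < a 0 j) -> (forall j, (B *m v) j 0 = l * (v j 0 / a 0 j)) ->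
  let u := map_mx (real_complex R) (\col_j (v j 0 / (a 0 j `^ (1 / 2)))) in
  mxpowR A (1 / 2) *m map_mx (real_complex R) B *m mxpowR A (1 / 2) *m u
  = l%:C *: u.
Proof.
move=> a0 Bv u; set G := mxpowR A _.
have d0 j : a 0 j `^ (1 / 2) != 0 by rewrite gt_eqF ?powR_gt0.
have Gu : G *m u = map_mx (real_complex R) v.
  apply/colP => j; rewrite mulmx_mxfun_diag !mxE -rmorphM /=.
  by rewrite mulrC divfK.
rewrite -(mulmxA _ G u) Gu -(mulmxA G) -map_mxM.
apply/colP => j; rewrite mulmx_mxfun_diag mxE Bv !mxE.
rewrite -!rmorphM /=; congr (_%:C); rewrite mulrCA; congr (_ * _).
have {2}-> : a 0 j = a 0 j `^ (1 / 2) * a 0 j `^ (1 / 2).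
  rewrite -powRD ?gt_eqF ?implybT//.
  by rewrite -splitr powRr1// ltW.
by field; exact: d0.
Qed.

End RealDiagonal.

(** * The 3 by 3 matrix B *)

Definition col3 (R : nzRingType) (x y z : R) : 'cV[R]_3 :=
  \col_i nth 0 [:: x; y; z] i.

(* [c kk^T + pp^T + 8 qq^T] for the orthogonal vectors k = (0,1,1),
   p = (2,-1,1), q = (1,1,-1): the eigenvalues are 2c, 6 and 24. *)
Definition Bmx (R : nzRingType) (c : R) : 'M[R]_3 := \matrix_(i, j)
  nth 0 (nth [::] [:: [:: 12; 6; -6]; [:: 6; c + 9; c - 9];
                      [:: -6; c - 9; c + 9]] i) j.

Section Matrix3.
Variable R : realType.
Implicit Types c : R.

Lemma mul_Bmx_col3 c (x y z : R) : Bmx R c *m col3 R x y z =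
  col3 R (12 * x + 6 * y - 6 * z) (6 * x + (c + 9) * y + (c - 9) * z)
    (- 6 * x + (c - 9) * y + (c + 9) * z).
Proof.
apply/colP => -[[|[|[|//]]] i3];
  by rewrite !mxE !big_ord_recl big_ord0 !mxE /=; ring.
Qed.

Lemma posdefmx_Bmx c : 0 < c -> posdefmx (map_mx (real_complex R) (Bmx R c)).
Proof.
move=> c0; split.
  rewrite hermsymmx_trC; apply/eqP/matrixP.
  move=> [[|[|[|//]]] i3] [[|[|[|//]]] j3];
  by rewrite !mxE /= conjC_real.
move=> v v0.
pose x := v ord0 0; pose y := v (lift ord0 ord0) 0.
pose z := v (lift ord0 (lift ord0 ord0)) 0.
(* The squares are those of the pairings of [v] with k, p and q, so they vanish together only for
   [v = 0]. *)
have -> : (v ^t* *m map_mx (real_complex R) (Bmx R c) *m v) 0 0 =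
    c%:C * `|y + z| ^+ 2 + `|2 * x - y + z| ^+ 2 + 8 * `|x + y - z| ^+ 2.
  rewrite !normCK !(rmorphB, rmorphD, rmorphM, conjC_nat) /=.
  rewrite !mxE !big_ord_recl !big_ord0 !mxE !big_ord_recl !big_ord0 !mxE /=.
  rewrite !(rmorphN, rmorphB, rmorphD, rmorph_nat) -/x -/y -/z /=.
  ring.
have cC : 0 < c%:C by rewrite ltcR.
have s1 : 0 <= c%:C * `|y + z| ^+ 2 by rewrite mulr_ge0// ?exprn_ge0// ltW.
have s2 : 0 <= `|2 * x - y + z| ^+ 2 by rewrite exprn_ge0.
have s3 : 0 <= 8 * `|x + y - z| ^+ 2 by rewrite mulr_ge0// exprn_ge0.
rewrite lt0r !addr_ge0// andbT !paddr_eq0// ?addr_ge0//.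
rewrite (mulf_eq0 c%:C) (mulf_eq0 8) !sqrf_eq0 !normr_eq0 pnatr_eq0.
rewrite (gt_eqF cC) /=.
apply: contra v0 => /andP[/andP[/eqP e1 /eqP e2] /eqP e3].
have x0 : x = 0.
  apply: (mulfI (_ : 3 != 0 :> R[i])); first by rewrite pnatr_eq0.
  by rewrite mulr0 -[RHS]addr0 -{1}e2 -e3; ring.
have z0 : z = 0.
  apply: (mulfI (_ : 2 != 0 :> R[i])); first by rewrite pnatr_eq0.
  by rewrite mulr0 -[RHS]subr0 -{1}e1 -e3 x0; ring.
have y0 : y = 0 by move: e1; rewrite z0 addr0.
apply/eqP/colP => -[[|[|[|//]]] i3]; rewrite mxE.
- by rewrite -[RHS]x0 /x; congr (v _ _); apply: val_inj.
- by rewrite -[RHS]y0 /y; congr (v _ _); apply: val_inj.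
- by rewrite -[RHS]z0 /z; congr (v _ _); apply: val_inj.
Qed.

(** Since p + q = 3 e_1, the vector B^s e_1 is (6^s p + 24^s q) / 3. The eigenvalue 2c does not
    enter because k is orthogonal to e_1. *)
Lemma powRmx_Bmx00 c s : 0 < c ->
  mxpowR (map_mx (real_complex R) (Bmx R c)) s 0 0 =
  ((2 * 6 `^ s + 24 `^ s) / 3)%:C.
Proof.
move=> c0; set B := map_mx _ _; have [Bh _] := posdefmx_Bmx c c0.
have pE : mxpowR B s *m map_mx (real_complex R) (col3 R 2 (- 1) 1) =
    (6 `^ s)%:C *: map_mx (real_complex R) (col3 R 2 (- 1) 1).
  apply: mxfun_eigenvector => //; rewrite -map_mxM -map_mxZ mul_Bmx_col3.
  congr map_mx; apply/colP => -[[|[|[|//]]] i3]; rewrite !mxE /=; ring.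
have qE : mxpowR B s *m map_mx (real_complex R) (col3 R 1 1 (- 1)) =
    (24 `^ s)%:C *: map_mx (real_complex R) (col3 R 1 1 (- 1)).
  apply: mxfun_eigenvector => //; rewrite -map_mxM -map_mxZ mul_Bmx_col3.
  congr map_mx; apply/colP => -[[|[|[|//]]] i3]; rewrite !mxE /=; ring.
have /colP/(_ 0) := congr2 +%R pE qE; rewrite -mulmxDr -map_mxD.
have -> : col3 R 2 (-1) 1 + col3 R 1 1 (-1) = 3 *: delta_mx 0 0.
  apply/colP => -[[|[|[|//]]] i3]; rewrite !mxE /=; ring.
rewrite map_mxZ -scalemxAr map_delta_mx -colE !mxE /= rmorph_nat => e.
apply: (mulfI (_ : 3 != 0 :> R[i])); first by rewrite pnatr_eq0.
rewrite e -[3 in RHS](rmorph_nat (real_complex R)) -!rmorphM -rmorphD /=.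
by congr (_%:C); field.
Qed.

End Matrix3.

(** * The scale L and the numerical estimate *)

Section Scale.
Variables (R : realType) (s : R).
Hypothesis s2 : 2 < s.
Let L : R := 45 `^ (s - 2)^-1.

Lemma scale_ge1 : 1 <= L.
Proof.
have s20 : 0 <= (s - 2)^-1 by rewrite invr_ge0 subr_ge0 ltW.
rewrite -[X in X <= _](powRr0 (45 : R)).
by apply: ler_powR => //; rewrite ler1n.
Qed.

Lemma scale_powR : L `^ s = 45 * L ^+ 2.
Proof.
have L0 : L != 0 by rewrite gt_eqF//; have := scale_ge1; lra.
have {1}-> : s = (s - 2) + 2%:R by rewrite subrK.
rewrite powRD ?L0 ?implybT// powR_mulrn ?powR_ge0//.
by rewrite -powRrM mulVf ?powRr1// subr_eq0 gt_eqF.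
Qed.

(** Compares (B^s)_11 with the lower bound for (C^s)_11, in units of 24^s: the left side is at most
    27 * (2/16 + 1) / 3 = 81/8, the right side at least 45/4. *)
Lemma scale_bound (t N : R) : t = (2 * L - 1)^-1 ->
  N = t ^+ 2 + 24 + (6 + 2 * t) / (4 * L) ->
  N * ((2 * 6 `^ s + 24 `^ s) / 3) < (24 * L) `^ s * t ^+ 2.
Proof.
have L1 := scale_ge1 => tE NE.
have t0 : 0 < t by rewrite tE invr_gt0; lra.
have tL : t * (2 * L - 1) = 1 by rewrite tE mulVf// gt_eqF//; lra.
have t1 : t <= 1 by rewrite tE invf_le1; lra.
have N27 : N <= 27.
  have : (6 + 2 * t) / (4 * L) <= 2 by rewrite ler_pdivrMr; lra.
  rewrite NE; nra.
have p6 : 0 < 6 `^ s :> R by rewrite powR_gt0.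
have p24 : 16 * 6 `^ s <= 24 `^ s :> R.
  have -> : 24 = 4 * 6 :> R by rewrite -natrM.
  rewrite powRM// ler_pM2r//.
  have -> : 16 = 4 `^ 2%:R :> R by rewrite powR_mulrn// -natrX.
  by apply: ler_powR; [rewrite ler1n | exact: ltW].
(* The definition of [t] gives 2 L t = 1 + t. *)
have L2t : 1 <= 4 * (L ^+ 2 * t ^+ 2).
  have : 1 <= 2 * (L * t) by nra.
  nra.
rewrite powRM//; last by lra.
rewrite scale_powR.
have -> : 24 `^ s * (45 * L ^+ 2) * t ^+ 2 = 24 `^ s * (45 * (L ^+ 2 * t ^+ 2)).
  ring.
have : N * ((2 * 6 `^ s + 24 `^ s) / 3) <= 27 * ((2 * 6 `^ s + 24 `^ s) / 3).
  by rewrite ler_wpM2r//; lra.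
have : 24 `^ s * (45 / 4) <= 24 `^ s * (45 * (L ^+ 2 * t ^+ 2)).
  by rewrite ler_wpM2l//; lra.
lra.
Qed.
End Scale.

(** * The counterexample *)

Lemma trace_counterexample (R : realType) (s : R) : 2 < s ->
  exists (A B : 'M[R[i]]_3) (I : interval R) (f : R -> R),
    [/\ posdefmx A /\ posdefmx B,
        spec A `<=` [set x%:C | x in [set` I]],
        [/\ forall x, x \in I -> 0 <= f x,
            {in I &, {homo f : x y / x <= y}}
          & {within [set` I], continuous f}]
      & \tr (mxfun f A *m mxpowR A s *m mxpowR B s)
        < \tr (mxfun f A
               *m mxpowR (mxpowR A (1 / 2) *m B *m mxpowR A (1 / 2)) s)].
Proof.
move=> s2; have L1 := scale_ge1 _ _ s2; have bound := scale_bound _ _ s2.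
set L := 45 `^ _ in L1 bound.
(* This [t] solves the first coordinate of B v = 24 L A^-1 v with a_1 = 1, namely 12 t + 12 = 24 L
   t. *)
set t := (2 * L - 1)^-1 in bound.
have t0 : 0 < t by rewrite invr_gt0; lra.
have tL : t * (2 * L - 1) = 1 by rewrite mulVf// gt_eqF//; lra.
have t1 : t <= 1 by rewrite invf_le1; lra.
(* The last two coordinates of B v are [6 * d2] and [6 * d3]; the equation B v = 24 L A^-1 v then
   dictates the last two entries of [a]. *)
pose d2 := 24 * L + 3 + t; pose d3 := 24 * L - 3 - t.
have d20 : 0 < d2 by rewrite /d2; lra.
have d30 : 0 < d3 by rewrite /d3; lra.
pose a : 'rV[R]_3 := \row_i nth 0 [:: 1; 12 * L / d2; 4 * L / d3] i.
pose v := col3 R t 3 1.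
pose B0 := Bmx R (36 * L).
have a0 j : 0 < a 0 j.
  by case: j => -[|[|[|//]]] j3; rewrite mxE /= ?ltr01// divr_gt0//; lra.
have Bv j : (B0 *m v) j 0 = 24 * L * (v j 0 / a 0 j).
  rewrite mul_Bmx_col3; case: j => -[|[|[|//]]] j3; rewrite !mxE /=.
  - by rewrite divr1; lra.
  - rewrite /d2; field; rewrite -/d2.
    by apply/andP; split; rewrite gt_eqF//; lra.
  - rewrite /d3; field; rewrite -/d3.
    by apply/andP; split; rewrite gt_eqF//; lra.
pose A := diag_mx (map_mx (real_complex R) a).
pose B := map_mx (real_complex R) B0.
(* The cutoff 1/2 separates the first diagonal entry of [A], which is 1, from the other two, which
   stay below 1/2. *)
pose f (x : R) := Num.max 0 (x - 1 / 2).
have Bpd : posdefmx B by apply: posdefmx_Bmx; lra.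
have f1 : f (a 0 0) = 1 / 2 by rewrite mxE /f /= max_r; lra.
have f0 k : k != 0 -> f (a 0 k) = 0.
  move=> k0; rewrite /f max_l// subr_le0.
  case: k k0 => -[|[|[|//]]] k3 // _; rewrite mxE /= ler_pdivrMr// /d2 /d3; lra.
exists A, B, `]-oo, +oo[%R, f; split.
- by split=> //; exact: posdefmx_diag.
- by move=> z /spec_diag[x _ <-]; exists x => //=; rewrite in_itv.
- split=> [x _|x y _ _ xy|].
  + by rewrite /f le_max lexx.
  + by rewrite /f ge_max !le_max lexx/= lerD2r xy orbT.
  + apply: continuous_subspaceT; apply: max_fun_continuous.
      exact: cst_continuous.
    by move=> x; apply: cvgB; [exact: cvg_id|exact: cvg_cst].
- set C := _ *m B *m _.
  rewrite -mulmxA !(mxtrace_mxfun_diag _ _ _ _ _ 0)// f1.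
  rewrite mulmx_mxfun_diag mxE /= powR1 mul1r powRmx_Bmx00; last by lra.
  rewrite ltr_pM2l ?ltcR ?divr_gt0 ?invr_gt0//.
  have Cu := sandwich_eigenvector _ _ _ _ _ _ a0 Bv.
  have Ch : C \is hermsymmx.
    by apply: hermsymmx_mul3; [exact: mxfun_hermsymmx|case: Bpd].
  have := mxfun_entry_ge _ _ (fun x => x `^ s) _ _ _ 0 Ch _ Cu.
  move=> /(_ (fun x => powR_ge0 x s)).
  set N := \sum_j _.
  (* [N] is the squared norm of A^(-1/2) v, that is, v^T A^-1 v. *)
  have NE : N = t ^+ 2 + 24 + (6 + 2 * t) / (4 * L).
    have uE j : (\col_j (v j 0 / a 0 j `^ (1 / 2))) j 0 ^+ 2
        = v j 0 ^+ 2 / a 0 j.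
      rewrite mxE expr_div_n; congr (_ / _).
      rewrite -powR_mulrn ?powR_ge0// -powRrM divrK ?unitfE ?pnatr_eq0//.
      by rewrite powRr1 ?ltW.
    rewrite /N (eq_bigr _ (fun j _ => uE j)) !big_ord_recl big_ord0 !mxE /=.
    by rewrite /d2 /d3; field; rewrite -/d2 -/d3 ?gt_eqF//; lra.
  have N0 : 0 < N.
    by rewrite NE addr_gt0 ?divr_gt0//; nra.
  rewrite !mxE /= powR1 divr1 => le_C.
  rewrite -(ltr_pM2l (_ : 0 < N%:C)) ?ltcR//.
  by apply: lt_le_trans le_C; rewrite -!rmorphM /= ltcR mul1r; exact: bound.
Qed.

Lemma posdefmx_semidef (R : realType) (n : nat) (A : 'M[R[i]]_n) :
  posdefmx A -> possemidefmx A.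
Proof.
move=> [Ah Apos]; split=> // v; have [->|v0] := eqVneq v 0.
  by rewrite mulmx0 mxE.
exact/ltW/Apos.
Qed.

Theorem theorem2p2 (R : realType) :
  (forall s : R, 2 < s ->
     exists (A B : 'M[R[i]]_3) (I : interval R) (f : R -> R),
       [/\ posdefmx A /\ posdefmx B,
           spec A `<=` [set x%:C | x in [set` I]],
           [/\ forall x, x \in I -> 0 <= f x,
               {in I &, {homo f : x y / x <= y}}
             & {within [set` I], continuous f}]
         & \tr (mxfun f A *m mxpowR A s *m mxpowR B s)
           < \tr (mxfun f A
                  *m mxpowR (mxpowR A (1 / 2) *m B *m mxpowR A (1 / 2)) s)])
  /\
  ~ (forall s : R, 1 <= s ->
     forall (n : nat) (A B : 'M[R[i]]_n) (I : interval R) (f : R -> R),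
       possemidefmx A -> possemidefmx B ->
       spec A `<=` [set x%:C | x in [set` I]] ->
       (forall x, x \in I -> 0 <= f x) ->
       {in I &, {homo f : x y / x <= y}} ->
       \tr (mxfun f A *m mxpowR A s *m mxpowR B s)
       >= \tr (mxfun f A
               *m mxpowR (mxpowR A (1 / 2) *m B *m mxpowR A (1 / 2)) s)).
Proof.
split; first exact: trace_counterexample.
(* The exponent 3 serves as a sample value above 2. *)
have [A [B [I [f [[Apd Bpd] sA [f0 fmon _] lt_tr]]]]] :=
  trace_counterexample R 3 ltac:(lra).
move=> /(_ 3 ltac:(lra) 3%N A B I f (posdefmx_semidef _ _ _ Apd)
  (posdefmx_semidef _ _ _ Bpd) sA f0 fmon).
by rewrite (lt_geF lt_tr).
Qed.
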